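(* Let $N\in\mathbb{N}$. For $z, c\neq q^{-n}$, $1\leq n\leq N$, \begin{equation*} \sum_{n=1}^{N}\genfrac{[}{]}{0pt}{}{N}{n}\frac{(-1)^{n-1}z^nq^{\frac{n(n+1)}{2}}(q)_{n}}{(1-cq^{n})(zq)_n}= \frac{z}{c}\sum_{n=1}^{N}\genfrac{[}{]}{0pt}{}{N}{n}\frac{(zq/c)_{n-1}(q)_{n} (cq)_{N-n} (cq)^{n}}{(zq)_{n}(cq)_{N}}. \end{equation*}
   Context: Here $|q|<1$, $(A)_n=(A;q)_n=(1-A)(1-Aq)\cdots(1-Aq^{n-1})$ with $(A)_0=1$, and $\genfrac{[}{]}{0pt}{}{N}{n}=\frac{(q;q)_N}{(q;q)_n(q;q)_{N-n}}$ for $0\le n\le N$ is the $q$-binomial coefficient. *)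

(* Defs.v *)
From mathcomp Require Import all_boot all_order all_algebra.
From mathcomp Require Import reals complex.
Set Implicit Arguments.
Unset Strict Implicit.
Unset Printing Implicit Defensive.
Local Open Scope ring_scope.

Definition qpoch (F : fieldType) (q a : F) (n : nat) : F :=
  \prod_(i < n) (1 - a * q ^+ i).

(* The subtraction is truncated: only meaningful for n <= N. *)
Definition qbinom (F : fieldType) (q : F) (N n : nat) : F :=
  qpoch q q N / (qpoch q q n * qpoch q q (N - n)).

(* Main.v *)
Require Import Defs.
From mathcomp Require Import all_boot all_order all_algebra.
From mathcomp Require Import reals complex.
From mathcomp Require Import ring.
Set Implicit Arguments.
Unset Strict Implicit.
Unset Printing Implicit Defensive.
Import Order.TTheory GRing.Theory Num.Theory.
Local Open Scope ring_scope.
Local Open Scope complex_scope.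

(** Write $S_N(z,c)$ for either side. Both sides vanish for $N = 0$ and satisfy
    $$S_N(z,c) = \frac{zq(1-q^N)}{1-zq}
        \left(\frac{1}{1-cq} - S_{N-1}(zq,cq)\right).$$
    On the left this is a shift of the summation index; on the right the terms
    of $S_N(z,c) + \frac{zq(1-q^N)}{1-zq} S_{N-1}(zq,cq)$ telescope. The case
    $q = 0$, where both sides vanish termwise, is treated apart. *)

Section QPochhammer.
Variables (F : fieldType) (q : F).

Lemma qpoch0 a : qpoch q a 0 = 1.
Proof. by rewrite /qpoch big_ord0. Qed.

Lemma qpochSr a n : qpoch q a n.+1 = qpoch q a n * (1 - a * q ^+ n).
Proof. by rewrite /qpoch big_ord_recr. Qed.

Lemma qpochSl a n : qpoch q a n.+1 = (1 - a) * qpoch q (a * q) n.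
Proof.
rewrite /qpoch big_ord_recl expr0 mulr1; congr (_ * _).
by apply: eq_bigr => i _; rewrite /= exprS mulrA.
Qed.

Lemma qpoch_neq0 a n :
  (forall i, (i < n)%N -> 1 - a * q ^+ i != 0) -> qpoch q a n != 0.
Proof. by move=> h; apply/prodf_neq0 => i _; apply: h. Qed.

End QPochhammer.

Lemma triangularS n : ((n.+1 * n.+2) %/ 2 = n.+1 + (n * n.+1) %/ 2)%N.
Proof.
have -> : (n.+1 * n.+2 = n.+1 * 2 + n * n.+1)%N by ring.
by rewrite divnMDl.
Qed.

Section Recurrences.
Variables (F : fieldType) (q : F).

Definition lhs_term (z c : F) (N n : nat) : F :=
  qbinom q N n *
     (((-1) ^+ n.-1 * z ^+ n * q ^+ ((n * n.+1) %/ 2) * qpoch q q n) /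
      ((1 - c * q ^+ n) * qpoch q (z * q) n)).

Definition rhs_term (z c : F) (N n : nat) : F :=
  qbinom q N n *
     ((qpoch q (z * q / c) n.-1 * qpoch q q n * qpoch q (c * q) (N - n)
        * (c * q) ^+ n) /
      (qpoch q (z * q) n * qpoch q (c * q) N)).

(* Gosper antidifference of the combined right-hand terms, up to sign. *)
Definition rhs_cert (z c : F) (N n : nat) : F :=
  qbinom q N n *
     ((qpoch q (z * q / c) n.-1 * qpoch q q n * qpoch q (c * q * q) (N - n)
        * (c * q) ^+ n) /
      (qpoch q (z * q) n * qpoch q (c * q) N)).

(** Inverse-free form of $a \neq q^{-n}$, meaningful at $q = 0$ as well. At $a = 1$ it keeps $(q)_N$
    from vanishing. *)
Definition no_pole (a : F) (N : nat) :=
  forall n, (0 < n <= N)%N -> 1 - a * q ^+ n != 0.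

Lemma no_pole_shift a N : no_pole a N.+1 -> no_pole (a * q) N.
Proof.
by move=> h n /andP[_ nN]; rewrite -mulrA -exprS; apply: h.
Qed.

Lemma no_poleW a M N : (M <= N)%N -> no_pole a N -> no_pole a M.
Proof.
move=> MN h n /andP[n0 nM]; apply: h.
by rewrite n0 (leq_trans nM MN).
Qed.

Lemma no_pole_qpoch a N : no_pole a N -> qpoch q (a * q) N != 0.
Proof.
move=> h; apply: qpoch_neq0 => i iN.
by rewrite -mulrA -exprS; apply: h.
Qed.

Lemma no_pole1_qpoch N : no_pole 1 N -> qpoch q q N != 0.
Proof. by move/no_pole_qpoch; rewrite mul1r. Qed.

(** Each factor of the term absorbs the shift $(z,c) \mapsto (zq,cq)$: the triangular exponent grows
    by $n+1$, which turns $z^{n+1}$ into $zq \cdot (zq)^n$, and $(zq)_{n+1} = (1-zq)(zq^2)_n$. *)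
Lemma lhs_termS z c N n : (0 < n <= N)%N ->
  no_pole 1 N.+1 -> no_pole z N.+1 -> no_pole c N.+1 ->
  lhs_term z c N.+1 n.+1 =
  - (z * q * (1 - q ^+ N.+1) / (1 - z * q)) * lhs_term (z * q) (c * q) N n.
Proof.
move=> /andP[n0 nN] h1 hz hc.
have hqn : qpoch q q n.+1 != 0 by apply/no_pole1_qpoch/(no_poleW _ h1).
have hqm : qpoch q q (N - n) != 0.
  by apply/no_pole1_qpoch/(no_poleW _ h1)/(leq_trans (leq_subr _ _)).
have hzn : qpoch q (z * q) n.+1 != 0 by apply/no_pole_qpoch/(no_poleW _ hz).
have hcn : 1 - c * q ^+ n.+1 != 0 by apply: hc.
rewrite /lhs_term /qbinom subSS triangularS exprD /=.
(* This fails at $n = 0$, where [n.-1] is truncated; hence the first term of the sum is handled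
   separately. *)
have -> : (-1) ^+ n = - (-1) ^+ n.-1 :> F.
  by case: n n0 {nN hqn hqm hzn hcn} => // n _; rewrite exprS mulN1r.
move: hqn hqm hzn hcn; rewrite (qpochSr q q N) (qpochSr q q n).
rewrite (qpochSl q (z * q) n) !mulf_eq0 !negb_or !exprS exprMn.
move=> /andP[hqn hqn'] hqm /andP[hz1 hzn] hcn.
rewrite mulrA in hcn.
by field; rewrite hqn hqn' hqm hz1 hzn hcn.
Qed.

Lemma rhs_term_telescope z c N n : q != 0 -> c != 0 -> (0 < n <= N)%N ->
  no_pole 1 N.+1 -> no_pole z N.+1 -> no_pole c N.+1 ->
  rhs_term z c N.+1 n
    + z * q * (1 - q ^+ N.+1) / (1 - z * q) * rhs_term (z * q) (c * q) N n
  = rhs_cert z c N.+1 n - rhs_cert z c N.+1 n.+1.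
Proof.
move=> q0 c0; case: n => // k /andP[_ kN] h1 hz hc.
(* With $m = N-n$ the truncated subtractions disappear, and $q^N$ splits as $q \cdot q^k \cdot
   q^m$. *)
have [m eN] : exists m, (N = k.+1 + m)%N by exists (N - k.+1)%N; rewrite subnKC.
have hqk : qpoch q q k.+2 != 0 by apply/no_pole1_qpoch/(no_poleW _ h1).
have hqm : qpoch q q m.+1 != 0.
  by apply/no_pole1_qpoch/(no_poleW _ h1); rewrite eN ltnS leq_addl.
have hzn : qpoch q (z * q) k.+2 != 0 by apply/no_pole_qpoch/(no_poleW _ hz).
have hcN : qpoch q (c * q) N.+1 != 0 by apply/no_pole_qpoch.
have e1 : (N - k = m.+1)%N by rewrite eN addSn -addnS addKn.
have e2 : (N - k.+1 = m)%N by rewrite eN addKn.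
rewrite /rhs_term /rhs_cert /qbinom !subSS e1 e2 [k.+1.-1]/= [k.+2.-1]/=.
have -> : z * q * q / (c * q) = z * q / c by field; rewrite q0 c0.
have eqN : q ^+ N = q * q ^+ k * q ^+ m by rewrite eN exprD exprS.
move: hqk hqm hzn hcN.
(* All symbols are reduced to $(q)_N, (q)_k, (q)_m, (zq^2)_k, (zq/c)_k, (cq^2)_m, (cq^2)_N$; what
   remains is a rational identity in $q^k$ and $q^m$. *)
rewrite (qpochSr q q N) !(qpochSl q (c * q) _) (qpochSl q (z * q) k.+1).
rewrite (qpochSl q (z * q) k) !(qpochSr q (z * q * q) k).
rewrite (qpochSr q (c * q * q) m) (qpochSr q (z * q / c) k) (qpochSr q q k.+1).
rewrite (qpochSr q q k) (qpochSr q q m).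
rewrite !mulf_eq0 !negb_or !exprS !exprMn eqN.
move=> /andP[/andP[k1 k2] k3] /andP[m1 m2] /andP[z1 /andP[z2 z3]] /andP[c1 c2].
by field; rewrite ?k1 ?k2 ?k3 ?m1 ?m2 ?z1 ?z2 ?z3 ?c1 ?c2 ?c0 ?q0.
Qed.

Lemma lhs_sumS z c N :
  no_pole 1 N.+1 -> no_pole z N.+1 -> no_pole c N.+1 ->
  \sum_(1 <= n < N.+2) lhs_term z c N.+1 n =
  z * q * (1 - q ^+ N.+1) / (1 - z * q) *
    ((1 - c * q)^-1 - \sum_(1 <= n < N.+1) lhs_term (z * q) (c * q) N n).
Proof.
move=> h1 hz hc; rewrite big_ltn // big_add1 /= mulrBr mulr_sumr -sumrN.
congr (_ + _); last first.
  apply: eq_big_nat => n nN.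
  by rewrite lhs_termS // mulNr.
have hqN : qpoch q q N != 0 by apply/no_pole1_qpoch/(no_poleW _ h1).
have hq1 : 1 - q != 0 by move: (h1 1%N isT); rewrite mul1r expr1.
have hz1 : 1 - z * q != 0 by move: (hz 1%N isT); rewrite expr1.
have hc1 : 1 - c * q != 0 by move: (hc 1%N isT); rewrite expr1.
rewrite /lhs_term /qbinom subSS subn0 (qpochSr q q N) !(qpochSr q _ 0) !qpoch0.
rewrite -exprS -[(_ %/ 2)%N]/1%N /= !expr1 !expr0.
by field; rewrite hqN hq1 hz1 hc1.
Qed.

Lemma rhs_sumS z c N : q != 0 -> c != 0 ->
  no_pole 1 N.+1 -> no_pole z N.+1 -> no_pole c N.+1 ->
  z / c * (\sum_(1 <= n < N.+2) rhs_term z c N.+1 n) =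
  z * q * (1 - q ^+ N.+1) / (1 - z * q) *
    ((1 - c * q)^-1 - z * q / (c * q) *
       \sum_(1 <= n < N.+1) rhs_term (z * q) (c * q) N n).
Proof.
move=> q0 c0 h1 hz hc; set K := z * q * _ / _.
have -> : z * q / (c * q) = z / c by field; rewrite q0 c0.
(* Only the lower end of the telescope survives, and $z/c$ times it is $K/(1-cq)$. *)
suff tele : \sum_(1 <= n < N.+2) rhs_term z c N.+1 n +
   K * (\sum_(1 <= n < N.+1) rhs_term (z * q) (c * q) N n) =
   rhs_cert z c N.+1 1.
  apply/eqP; rewrite mulrBr eq_sym subr_eq mulrCA -mulrDr tele; apply/eqP.
  have hqN : qpoch q q N != 0 by apply/no_pole1_qpoch/(no_poleW _ h1).
  have hq1 : 1 - q != 0 by move: (h1 1%N isT); rewrite mul1r expr1.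
  have hz1 : 1 - z * q != 0 by move: (hz 1%N isT); rewrite expr1.
  have := no_pole_qpoch hc.
  rewrite /K /rhs_cert /qbinom subSS subn0 (qpochSr q q N) !(qpochSr q _ 0).
  rewrite (qpochSl q (c * q) N) !qpoch0 mulf_eq0 negb_or => /andP[hc1 hcN].
  rewrite -exprS /= !expr1 !expr0.
  by field; rewrite hqN hq1 hz1 hc1 hcN c0.
(* The top term $n = N+1$ has no partner in the shorter sum. It cancels the upper end of the
   telescope, since there $(cq)_0 = (cq^2)_0 = 1$. *)
rewrite big_nat_recr //= mulr_sumr addrAC -big_split /=.
rewrite (telescope_sumr_eq (fun n => - rhs_cert z c N.+1 n)) //=.
  have -> : rhs_term z c N.+1 N.+1 = rhs_cert z c N.+1 N.+1.
    by rewrite /rhs_term /rhs_cert subnn !qpoch0.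
  by rewrite opprK addrAC addNr add0r.
by move=> n nN; rewrite rhs_term_telescope // opprK addrC.
Qed.

Lemma lhs_sum_eq_rhs_sum z c N : q != 0 -> c != 0 ->
  no_pole 1 N -> no_pole z N -> no_pole c N ->
  \sum_(1 <= n < N.+1) lhs_term z c N n =
  z / c * \sum_(1 <= n < N.+1) rhs_term z c N n.
Proof.
(* The induction keeps $z$ and $c$ general because the recurrence replaces them by $zq$ and $cq$. *)
move=> q0; elim: N z c => [|N IHN] z c c0 h1 hz hc.
  by rewrite !big_geq // mulr0.
rewrite lhs_sumS // rhs_sumS // IHN ?mulf_neq0 //.
- exact: no_poleW h1.
- exact: no_pole_shift.
- exact: no_pole_shift.
Qed.

End Recurrences.

Lemma neq_expV_no_pole (F : fieldType) (q a : F) N :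
  (forall n, (1 <= n <= N)%N -> q != 0 -> a != q ^- n) -> no_pole q a N.
Proof.
move=> h n nN; have [-> | q0] := eqVneq q 0.
  by case: n nN => // n _; rewrite expr0n mulr0 subr0 oner_neq0.
apply: contra (h n nN q0); rewrite subr_eq0 => /eqP e.
by rewrite -[X in _ == X]mul1r e mulfK // expf_neq0.
Qed.

Theorem theorem1p2 (R : realType) (N : nat) (q z c : R[i])
    (hq : `|q| < 1) (hc0 : c != 0)
    (hz : forall n : nat, (1 <= n <= N)%N -> q != 0 -> z != q ^- n)
    (hc : forall n : nat, (1 <= n <= N)%N -> q != 0 -> c != q ^- n) :
  \sum_(1 <= n < N.+1)
     qbinom q N n *
     (((-1) ^+ n.-1 * z ^+ n * q ^+ ((n * n.+1) %/ 2) * qpoch q q n) /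
      ((1 - c * q ^+ n) * qpoch q (z * q) n))
  = z / c *
    \sum_(1 <= n < N.+1)
     qbinom q N n *
     ((qpoch q (z * q / c) n.-1 * qpoch q q n * qpoch q (c * q) (N - n)
        * (c * q) ^+ n) /
      (qpoch q (z * q) n * qpoch q (c * q) N)).
Proof.
have [q0 | q0] := eqVneq q 0.
  (* The recurrence needs $cq \neq 0$. Here, for $n \geq 1$, the factors $(cq)^n$ and $q^{n(n+1)/2}$
     are zero. *)
  rewrite !big_nat !big1 ?mulr0 // => -[|n] // _; rewrite q0.
  - by rewrite (mulr0 c) expr0n /= mulr0 mul0r mulr0.
  - by rewrite triangularS expr0n /= mulr0 !mul0r mulr0.
apply: lhs_sum_eq_rhs_sum => //; try exact: neq_expV_no_pole.
(* No pole at $a = 1$: $q^n = 1$ would force $|q|^n = 1$, against $|q| < 1$. *)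
move=> n /andP[n0 _]; rewrite mul1r subr_eq0 eq_sym.
by apply: contraTneq hq => q1; rewrite -(expr_lt1 n0) // -normrX q1 normr1 ltxx.
Qed.
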